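(* Let $(\Omega,\mathcal{F},P)$ be a probability space with a filtration $(\mathcal{F}_t)_{t\ge 0}$, and let $\{Z_t\}_{t=0,1,\dots}$ be a process adapted to this filtration with $Z_t\in L_2(\mathcal{F}_t)$ for all $t$. Assume that the process is a.s. non-increasing (i.e. $Z_{t+1}\le Z_t$ a.s. for all $t\ge 0$) and has uniformly bounded support. For each $t\ge 1$ let $\sigma_{t|\mathcal{F}_{t-1}}$ be a conditional risk measure that is coherent and support-bounded. Then $$\rho_\infty(Z)=\lim_{t\to\infty}\rho_t(Z_t),\qquad \rho_t(Z_t)=\sigma_{1|\mathcal{F}_0}\bigl(\sigma_{2|\mathcal{F}_1}(\cdots\sigma_{t|\mathcal{F}_{t-1}}(Z_t)\cdots)\bigr),$$ exists, as an a.s. limit.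
   Context: Write $L_2=L_2(\Omega,\mathcal{F},P)$ and $L_2(\mathcal{G})$ for the square-integrable $\mathcal{G}$-measurable random variables. Inequalities between random variables are a.s. A conditional risk measure $\sigma_{t|\mathcal{F}_{t-1}}$ assigns to a random variable in $L_2$ an $\mathcal{F}_{t-1}$-measurable random variable. It is called coherent if it is measurable in this sense and: - monotone: $\sigma_{t|\mathcal{F}_{t-1}}(X)\ge\sigma_{t|\mathcal{F}_{t-1}}(Y)$ whenever $X\ge Y$, $X,Y\in L_2$; - sub-additive: $\sigma_{t|\mathcal{F}_{t-1}}(X+Y)\le\sigma_{t|\mathcal{F}_{t-1}}(X)+\sigma_{t|\mathcal{F}_{t-1}}(Y)$ for $X,Y\in L_2$; - translation invariant: $\sigma_{t|\mathcal{F}_{t-1}}(X+C)=\sigma_{t|\mathcal{F}_{t-1}}(X)+C$ for $C\in L_2(\mathcal{F}_{t-1})$, $X\in L_2$; - positively homogeneous: $\sigma_{t|\mathcal{F}_{t-1}}(\Lambda X)=\Lambda\,\sigma_{t|\mathcal{F}_{t-1}}(X)$ for $\Lambda\in L_2(\mathcal{F}_{t-1})$, $\Lambda\ge 0$, $X\in L_2$ (with $\Lambda X\in L_2$). It is called support-bounded if for every $X\in L_2$ we have $\sigma_{t|\mathcal{F}_{t-1}}(X)\in[a,b]$ a.s., where $a=\operatorname{ess\,inf}(X)$ and $b=\operatorname{ess\,sup}(X)$. A process $\{Z_t\}$ has uniformly bounded support if there exist finite $a<b$ such that the support of (the distribution of) $Z_t$ is contained in $[a,b]$ for all $t$. By convention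 $\rho_0(Z_0)=Z_0$. *)

(* Defs.v *)
From mathcomp Require Export all_boot all_order all_algebra.
From mathcomp Require Export all_classical all_reals all_analysis ess_sup_inf.

Set Implicit Arguments.
Unset Strict Implicit.
Unset Printing Implicit Defensive.
Import Order.TTheory GRing.Theory Num.Theory.
Import numFieldNormedType.Exports.

Local Open Scope classical_set_scope.
Local Open Scope ring_scope.

Section sub_sigma_algebras.
Context d (T : measurableType d) (R : realType).

Definition filtration (F : nat -> set (set T)) : Prop :=
  [/\ forall t, sigma_algebra setT (F t),
      forall t, F t `<=` measurable &
      forall s t, (s <= t)%N -> F s `<=` F t].

(* Measurability with respect to a sub-sigma-algebra G: the measurable sets of
   [g_sigma_algebraType G] are those of the sigma-algebra generated by G, that
   is G itself when G is a sigma-algebra. *)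
Definition measurable_wrt (G : set (set T)) (X : T -> R) : Prop :=
  measurable_fun [set: g_sigma_algebraType G] X.

End sub_sigma_algebras.

Section conditional_risk_measures.
Context d (T : measurableType d) (R : realType) (P : probability T R).

Definition L2 (X : T -> R) : Prop := X \in Lfun P 2%:E.

Definition L2_wrt (G : set (set T)) (X : T -> R) : Prop :=
  L2 X /\ measurable_wrt G X.

(* A conditional risk measure given G is a map on functions [T -> R] of which
   only the values on square-integrable functions matter. Random variables are
   functions, not classes modulo a.s. equality; monotonicity makes the map
   compatible with a.s. equality. *)
Record coherent (G : set (set T)) (sigma : (T -> R) -> (T -> R)) : Prop := {
  coherent_measurable : forall X, L2 X -> measurable_wrt G (sigma X);
  coherent_monotone : forall X Y, L2 X -> L2 Y ->
    (\forall w \ae P, Y w <= X w) ->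
    \forall w \ae P, sigma Y w <= sigma X w;
  coherent_subadditive : forall X Y, L2 X -> L2 Y ->
    \forall w \ae P, sigma (X \+ Y) w <= sigma X w + sigma Y w;
  coherent_translation : forall C X, L2_wrt G C -> L2 X ->
    \forall w \ae P, sigma (X \+ C) w = sigma X w + C w;
  coherent_homogeneous : forall L X, L2_wrt G L ->
    (\forall w \ae P, 0 <= L w) -> L2 X -> L2 (L \* X) ->
    \forall w \ae P, sigma (L \* X) w = L w * sigma X w }.

Definition support_bounded (sigma : (T -> R) -> (T -> R)) : Prop :=
  forall X, L2 X -> \forall w \ae P,
    (ess_inf P (EFin \o X) <= (sigma X w)%:E <= ess_sup P (EFin \o X))%E.

End conditional_risk_measures.

Definition measure_support (R : realType) (mu : set R -> \bar R) : set R :=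
  [set x | forall U : set R, open U -> U x -> (0 < mu U)%E].

Definition uniformly_bounded_support d (T : measurableType d) (R : realType)
    (P : probability T R) (Z : nat -> {RV P >-> R}) : Prop :=
  exists a b : R, a < b /\
    forall t, measure_support (distribution P (Z t)) `<=` `[a, b].

(* [rho sigma t X] is sigma_1 (sigma_2 (... (sigma_t X))), with rho_0 the
   identity; [sigma 0] is not used. *)
Fixpoint rho d (T : measurableType d) (R : realType)
    (sigma : nat -> (T -> R) -> (T -> R)) (t : nat) (X : T -> R) : T -> R :=
  if t is s.+1 then rho sigma s (sigma t X) else X.

(* Main.v *)
Require Import Defs.
From mathcomp Require Import measurable_realfun.
(* Since Z_t is known at time t, sigma_{t+1}(Z_{t+1}) <= sigma_{t+1}(Z_t) = Z_t,
   where the equality is translation invariance together with sigma_{t+1}(0) = 0,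
   a consequence of support-boundedness. Applying the monotone map rho_t shows
   that rho_t(Z_t) is a.s. non-increasing; support-boundedness also keeps it in
   the interval [a, b] that contains the supports, so it converges a.s. *)
Set Implicit Arguments.
Unset Strict Implicit.
Unset Printing Implicit Defensive.
Import Order.TTheory GRing.Theory Num.Theory.
Import numFieldNormedType.Exports.
Local Open Scope classical_set_scope.
Local Open Scope ring_scope.

(* The complement of the support is covered by countably many null intervals
   with rational endpoints. *)
Lemma ae_measure_support d (T : measurableType d) (R : realType)
    (P : probability T R) (X : {RV P >-> R}) :
  \forall w \ae P, measure_support (distribution P X) (X w).
Proof.
pose V (p : rat * rat) : set R := [set` `]ratr p.1, ratr p.2[].
(* Pairs of rationals are enumerated by [unpickle]. Indices coding no pair and intervals of positive
   mass give [set0], so every [A n] is negligible. *)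
pose A n := if unpickle n is Some p then
  if `[< distribution P X (V p) = 0%E >] then X @^-1` V p else set0 else set0.
have A0 n : P.-negligible (A n).
  rewrite /A; case: unpickle => [p|]; last exact: negligible_set0.
  case: asboolP => [p0|_]; last exact: negligible_set0.
  exists (X @^-1` V p); split => //.
  by apply: measurable_funPTI; exact: measurable_itv.
apply: negligibleS (negligible_bigcup A0) => w /=.
move=> /existsNP[U] /not_implyP[oU] /not_implyP[Uw] /negP.
rewrite -leNgt => U0.
have /nbhs_ballP[e /= e0 eU] : nbhs (X w) U by exact: open_nbhs_nbhs.
have /rat_in_itvoo[p] : X w - e < X w by rewrite ltrBlDr ltrDl.
rewrite in_itv/= => /andP[ep pX].
have /rat_in_itvoo[q] : X w < X w + e by rewrite ltrDl.
rewrite in_itv/= => /andP[Xq qe].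
exists (pickle (p, q)); first exact: I.
rewrite /A pickleK asboolT; first by rewrite /V /= in_itv/= pX Xq.
apply/eqP; rewrite eq_le measure_ge0 andbT.
apply: le_trans U0; apply: le_measure; rewrite ?inE.
- exact: measurable_itv.
- exact: open_measurable.
- move=> y; rewrite /V /= in_itv/= => /andP[py yq]; apply: eU.
  by rewrite /ball /= ltr_distlC (lt_trans ep py) (lt_trans yq qe).
Qed.

Lemma measurable_wrt_measurable d (T : measurableType d) (R : realType)
    (G : set (set T)) (X : T -> R) :
  G `<=` measurable -> measurable_wrt G X -> measurable_fun [set: T] X.
Proof.
move=> Gm mX _ Y mY; have := mX measurableT Y mY.
apply: smallest_sub => //; exact: sigma_algebra_measurable.
Qed.

Lemma ae_nonincreasing_cvg d (T : measurableType d) (R : realType)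
    (P : probability T R) (a b : R) (f : nat -> T -> R) :
  (forall n, measurable_fun [set: T] (f n)) ->
  (forall n, \forall w \ae P, a <= f n w <= b) ->
  (forall n, \forall w \ae P, f n.+1 w <= f n w) ->
  exists g : {RV P >-> R}, \forall w \ae P, f n w @[n --> \oo] --> g w.
Proof.
move=> mf abf df.
(* The truncation makes every path bounded, so that the upper limit of [h] is
   measurable everywhere, not only off a null set. *)
pose h n w := Num.max a (Num.min b (f n w)).
have mh n : measurable_fun [set: T] (h n).
  apply: measurable_maxr; first exact: measurable_cst.
  by apply: measurable_minr; [exact: measurable_cst|exact: mf].
have mg : measurable_fun [set: T] (fun w => limn_sup (h ^~ w)).
  apply: measurable_fun_limn_sup => // w _.
    exists (Num.max a b) => _ [n _ <-].
    by rewrite /h ge_max !le_max !ge_min !lexx !orbT.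
  by exists a => _ [n _ <-]; rewrite /h le_max lexx.
(* Countably many a.s. conditions hold jointly off one null set; there the truncation is inactive
   and the path is monotone and bounded. *)
exists (mfun_Sub (mem_set mg)); have := ae_foralln df; have := ae_foralln abf.
apply: filterS2 => w abw dw.
have fh : h ^~ w = f ^~ w.
  apply/funext => n; have /andP[aw bw] := abw n.
  by rewrite /h (min_idPr bw) (max_idPr aw).
have cf : cvgn (f ^~ w).
  apply: nonincreasing_is_cvgn; first exact/nonincreasing_seqP.
  by exists a => _ [n _ <-]; case/andP: (abw n).
by rewrite /= fh cvg_limn_supE.
Qed.

Section bounded_random_variables.
Context d (T : measurableType d) (R : realType) (P : probability T R).
Variables a b : R.

(** [coherent] says nothing about [sigma X] being in [L2]. This class lies in [L2] and is stable
    under each one-step measure, so the axioms apply at every level of the iteration. *)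
Definition ae_bounded (X : T -> R) : Prop :=
  measurable_fun [set: T] X /\ \forall w \ae P, a <= X w <= b.

Lemma ae_bounded_L2 X : ae_bounded X -> L2 P X.
Proof.
case=> mX abX; have fP : P [set: T] \is a fin_num by exact: fin_num_measure.
have le12 : (1 <= 2%:E :> \bar R)%E by rewrite lee_fin ler1n.
(* On a space of finite mass the essentially bounded functions are square-integrable. *)
apply: (Lfun_subset le12 (leey _) fP (leey _)).
rewrite inE; apply/andP; split; rewrite inE//=.
rewrite /finite_norm unlock /Lnorm.
case: ifPn => [_|_]; last exact: ltry.
apply: (@le_lt_trans _ _ (Num.max `|a| `|b|)%:E); last exact: ltry.
apply/ess_supP; apply: filterS abX => w /andP[aX Xb].
rewrite /= lee_fin le_max; have [X0|X0] := ger0P (X w).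
  by rewrite (le_trans Xb (ler_norm _)) orbT.
by apply/orP; left; rewrite -[`|a|]normrN (le_trans _ (ler_norm _))// lerN2.
Qed.

Section one_step.
Variables (G : set (set T)) (s : (T -> R) -> (T -> R)).
Hypotheses (Gm : G `<=` measurable) (cs : coherent P G s)
  (bs : support_bounded P s).

Lemma risk_measure_ae_bounded X : ae_bounded X -> ae_bounded (s X).
Proof.
move=> bX; have LX := ae_bounded_L2 bX; split.
  exact: measurable_wrt_measurable Gm (coherent_measurable cs LX).
have aX : (a%:E <= ess_inf P (EFin \o X))%E.
  by apply/ess_infP; apply: filterS bX.2 => w /andP[? _]; rewrite lee_fin.
have Xb : (ess_sup P (EFin \o X) <= b%:E)%E.
  by apply/ess_supP; apply: filterS bX.2 => w /andP[_ ?]; rewrite lee_fin.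
apply: filterS (bs LX) => w /andP[sX Xs].
by rewrite -!lee_fin (le_trans aX sX) (le_trans Xs Xb).
Qed.

Lemma risk_measure_known X : L2_wrt P G X -> \forall w \ae P, s X w = X w.
Proof.
move=> GX; have L0 : L2 P (cst 0) by exact: Lfun_cst.
(* Positive total mass makes both essential bounds of the constant 0 equal to 0. *)
have P0 : (0 < P [set: T])%E by rewrite probability_setT.
have := coherent_translation cs GX L0; have := bs L0.
rewrite (_ : EFin \o cst 0 = cst 0%E)// ess_inf_cst// ess_sup_cst//.
have -> : cst 0 \+ X = X by apply/funext => w; rewrite /= add0r.
apply: filterS2 => w s0 ->.
by move: s0; rewrite !lee_fin => /le_anti <-; rewrite add0r.
Qed.

End one_step.

Section iterated.
Variables (F : nat -> set (set T)) (sigma : nat -> (T -> R) -> (T -> R)).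
Hypotheses (Fm : forall t, F t `<=` measurable)
  (csigma : forall t, (1 <= t)%N -> coherent P (F t.-1) (sigma t))
  (bsigma : forall t, (1 <= t)%N -> support_bounded P (sigma t)).

Lemma rho_ae_bounded t X : ae_bounded X -> ae_bounded (rho sigma t X).
Proof.
(* [rho] applies the innermost measure first, so the induction must hold for all [X]: it is used at
   [sigma t.+1 X]. *)
elim: t X => [//|t IH] X bX; apply: IH.
exact: risk_measure_ae_bounded (csigma _) (bsigma _) _ bX.
Qed.

Lemma rho_monotone t X Y : ae_bounded X -> ae_bounded Y ->
  (\forall w \ae P, Y w <= X w) ->
  \forall w \ae P, rho sigma t Y w <= rho sigma t X w.
Proof.
elim: t X Y => [//|t IH] X Y bX bY YX /=.
apply: IH; [exact: risk_measure_ae_bounded (csigma _) (bsigma _) _ bX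
  |exact: risk_measure_ae_bounded (csigma _) (bsigma _) _ bY|].
exact: (coherent_monotone (csigma _)) (ae_bounded_L2 bX) (ae_bounded_L2 bY) _.
Qed.

End iterated.
End bounded_random_variables.

Theorem theorem1 (d : measure_display) (T : measurableType d) (R : realType)
    (P : probability T R) (F : nat -> set (set T)) (Z : nat -> {RV P >-> R})
    (sigma : nat -> (T -> R) -> (T -> R)) :
  filtration F ->
  (forall t, L2_wrt P (F t) (Z t)) ->
  (forall t, \forall w \ae P, Z t.+1 w <= Z t w) ->
  uniformly_bounded_support Z ->
  (forall t, (1 <= t)%N -> coherent P (F t.-1) (sigma t)) ->
  (forall t, (1 <= t)%N -> support_bounded P (sigma t)) ->
  exists rho_oo : {RV P >-> R},
    \forall w \ae P, rho sigma t (Z t) w @[t --> \oo] --> rho_oo w.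
Proof.
move=> [_ Fm _] LZ dZ [a [b [_ supZ]]] csigma bsigma.
have bZ t : ae_bounded P a b (Z t).
  split=> //; apply: filterS (ae_measure_support (Z t)) => w /supZ /=.
  by rewrite in_itv.
have brho t := rho_ae_bounded Fm csigma bsigma t (bZ t).
apply: (ae_nonincreasing_cvg (fun t => (brho t).1) (fun t => (brho t).2)) => t.
(* Both terms are values of the same [rho sigma t], at [sigma t.+1 (Z t.+1)] and at [Z t], so it
   suffices to compare these arguments. *)
apply: (rho_monotone Fm csigma bsigma t (bZ t)) => /=.
  exact: risk_measure_ae_bounded (csigma t.+1 _) (bsigma t.+1 _) _ (bZ t.+1).
(* [sigma t.+1] is conditional on [F t], for which [Z t] is measurable. *)
have := risk_measure_known (csigma t.+1 isT) (bsigma t.+1 isT) (LZ t).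
have := coherent_monotone (csigma t.+1 isT) (LZ t).1 (LZ t.+1).1 (dZ t).
by apply: filterS2 => w ? <-.
Qed.
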